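(* Let $K_\nu$ be the modified Bessel function of index $\nu$. Then $$\forall\nu>0,\ \forall y>0,\qquad \frac{K_\nu(y)}{K_{\nu+1}(y)}<\frac1y\left(\sqrt{y^2+\nu^2}-\nu\right).$$
   Context: $K_\nu$ is the usual modified Bessel function of the second kind (Macdonald function) of index $\nu$. *)

(* Defs.v *)
From Stdlib Require Import Reals.
From Coquelicot Require Import Coquelicot.
Open Scope R_scope.

(* Modified Bessel function of the second kind (Macdonald function) of real
   index nu at a real argument y > 0, by the classical formula
     K_nu(y) = int_0^oo exp(- y cosh t) cosh(nu t) dt.
   The integral converges for every nu when y > 0; for y <= 0 the value is
   meaningless. *)
Definition BesselK (nu y : R) : R :=
  RInt_gen (fun t : R => exp (- (y * cosh t)) * cosh (nu * t))
           (at_point 0) (Rbar_locally p_infty).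

(* Main.v *)
Require Import Defs.
From Stdlib Require Import Reals Lra Psatz.
From Coquelicot Require Import Coquelicot.
Open Scope R_scope.

(** Put [r = K_{nu+1}(y) / K_nu(y)].  Since
    [(sqrt (y^2 + nu^2) - nu) / y = y / (sqrt (y^2 + nu^2) + nu)], the claim says
    that [y r] exceeds the positive root of [X^2 - 2 nu X - y^2], that is,
    [y K_{nu+1}^2 - 2 nu K_nu K_{nu+1} - y K_nu^2 > 0].  By the recurrence
    [y (K_{nu+1} - K_{nu-1}) = 2 nu K_nu] ([BesselK_recurrence], an integration
    by parts) the left-hand side is [y (K_{nu-1} K_{nu+1} - K_nu^2)], so the
    claim is equivalent to the strict Turan inequality
    [K_nu^2 < K_{nu-1} K_{nu+1}] ([BesselK_turan]).  The latter is the
    Cauchy-Schwarz inequality for the integral representation of [K]: the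
    quadratic form [lam^2 K_{nu+1} - 2 lam K_nu + K_{nu-1}] has a positive
    integrand ([cosh_quadratic_pos]), and taking [lam = K_nu / K_{nu+1}]
    gives the inequality. *)

(** * Improper integrals of positive dominated functions *)

(** The partial integrals increase and are bounded by [C], so they converge to
    their supremum, which is at least the integral over [[0, 1]]. *)
Lemma is_RInt_gen_pos_dominated (f : R -> R) (C : R) :
  (forall t, continuous f t) ->
  (forall t, 0 < t -> 0 < f t <= C * exp (- t)) ->
  exists l, 0 < l /\ is_RInt_gen f (at_point 0) (Rbar_locally p_infty) l.
Proof.
intros Hc Hf.
assert (Hex : forall a b, ex_RInt f a b).
{ intros a b; apply (ex_RInt_continuous (V := R_CompleteNormedModule)); auto. }
assert (HC : 0 < C).
{ destruct (Hf 1 Rlt_0_1) as [Hf1 Hf2].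
  apply (Rmult_lt_reg_r (exp (Ropp 1))); [apply exp_pos | lra]. }
assert (Hincr : forall a b, 0 <= a <= b -> RInt f 0 a <= RInt f 0 b).
{ intros a b Hab.
  rewrite <- (RInt_Chasles f 0 a b) by apply Hex.
  assert (0 <= RInt f a b).
  { apply RInt_ge_0; [lra | apply Hex |].
    intros x Hx; apply Rlt_le, Hf; lra. }
  unfold plus; simpl; lra. }
assert (Hexp : forall b, is_RInt (fun t => C * exp (- t)) 0 b (C - C * exp (- b))).
{ intros b.
  replace (C - C * exp (- b))
    with (minus (- C * exp (- b)) (- C * exp (- 0))).
  2: { unfold minus, plus, opp; simpl; rewrite Ropp_0, exp_0; ring. }
  apply (is_RInt_derive (fun t => - C * exp (- t))).
  - intros x _; auto_derive; [easy | ring].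
  - intros x _; apply (ex_derive_continuous (V := R_NormedModule)).
    auto_derive; easy. }
assert (Hbound : forall b, 0 <= b -> RInt f 0 b <= C).
{ intros b Hb.
  apply Rle_trans with (RInt (fun t => C * exp (- t)) 0 b).
  - apply RInt_le; [easy | apply Hex | eexists; apply Hexp |].
    intros x Hx; apply Hf; lra.
  - rewrite (is_RInt_unique _ _ _ _ (Hexp b)).
    assert (He := exp_pos (- b)); nra. }
destruct (completeness (fun x => exists b, 0 <= b /\ x = RInt f 0 b))
  as [l [Hub Hlub]].
{ exists C; intros x [b [Hb ->]]; auto. }
{ exists (RInt f 0 0), 0; split; [lra | easy]. }
exists l; split.
{ apply Rlt_le_trans with (RInt f 0 1).
  - apply RInt_gt_0; [lra | intros x Hx; apply Hf; lra | auto].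
  - apply Hub; exists 1; split; [lra | easy]. }
intros P [eps HP].
assert (Hb0 : exists b0, 0 <= b0 /\ l - eps < RInt f 0 b0).
{ apply Classical_Prop.NNPP; intros Hn.
  assert (l <= l - eps).
  { apply Hlub; intros x [b [Hb ->]].
    apply Rnot_lt_le; intros Hlt; apply Hn; now exists b. }
  assert (H0 := cond_pos eps); lra. }
destruct Hb0 as [b0 [Hb0 Hlb]].
apply (Filter_prod _ _ _ (fun x => x = 0) (fun x => b0 < x)).
- easy.
- exists b0; easy.
- intros x b -> Hb; simpl.
  exists (RInt f 0 b); split.
  + apply (RInt_correct (V := R_CompleteNormedModule)), Hex.
  + apply HP.
    change (Rabs (RInt f 0 b - l) < eps).
    assert (RInt f 0 b0 <= RInt f 0 b) by (apply Hincr; lra).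
    assert (RInt f 0 b <= l) by (apply Hub; exists b; split; [lra | easy]).
    apply Rabs_def1; lra.
Qed.

(** * The integral representation of K *)

(** Because [cosh t >= t^2 / 8], completing the square in
    [y t^2 / 8 - (m + 1) t] shows that the weight beats any exponential. *)
Lemma exp_cosh_decay (y m t : R) :
  0 < y -> 0 <= t ->
  exp (- (y * cosh t)) * exp (m * t) <= exp (2 * (m + 1) ^ 2 / y) * exp (- t).
Proof.
intros Hy Ht.
rewrite <- !exp_plus.
assert (Hcosh : t ^ 2 / 8 <= cosh t).
{ unfold cosh.
  assert (H1 := exp_ineq1_le (t / 2)).
  assert (H2 := exp_pos (- t)).
  assert (H3 : exp t = exp (t / 2) * exp (t / 2)).
  { rewrite <- exp_plus; f_equal; field. }
  rewrite H3; nra. }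
assert (Hsq : - (y * (t ^ 2 / 8)) + m * t
              = 2 * (m + 1) ^ 2 / y + - t
                - (y * t - 4 * (m + 1)) ^ 2 / (8 * y)) by (field; lra).
assert (Hnn : 0 <= (y * t - 4 * (m + 1)) ^ 2 / (8 * y)).
{ apply Rdiv_le_0_compat; [apply pow2_ge_0 | lra]. }
assert (Hle : - (y * cosh t) + m * t <= 2 * (m + 1) ^ 2 / y + - t) by nra.
destruct Hle as [Hlt | ->]; [apply Rlt_le, exp_increasing, Hlt | apply Rle_refl].
Qed.

Lemma cosh_pos (x : R) : 0 < cosh x.
Proof.
unfold cosh.
assert (H1 := exp_pos x); assert (H2 := exp_pos (- x)); lra.
Qed.

Lemma exp_le_compat (a b : R) : a <= b -> exp a <= exp b.
Proof.
intros [H | ->]; [apply Rlt_le, exp_increasing, H | apply Rle_refl].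
Qed.

Lemma cosh_le_exp_Rabs (mu t : R) : 0 <= t -> cosh (mu * t) <= exp (Rabs mu * t).
Proof.
intros Ht; unfold cosh.
assert (H1 : exp (mu * t) <= exp (Rabs mu * t)).
{ apply exp_le_compat, Rmult_le_compat_r; [easy | apply Rle_abs]. }
assert (H2 : exp (- (mu * t)) <= exp (Rabs mu * t)).
{ apply exp_le_compat.
  rewrite <- Ropp_mult_distr_l_reverse, <- Rabs_Ropp.
  apply Rmult_le_compat_r; [easy | apply Rle_abs]. }
lra.
Qed.

Lemma Rabs_sinh_le_cosh (x : R) : Rabs (sinh x) <= cosh x.
Proof.
unfold sinh, cosh.
assert (H1 := exp_pos x); assert (H2 := exp_pos (- x)).
apply Rabs_le; lra.
Qed.

Lemma BesselK_integrand_continuous (mu y t : R) :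
  continuous (fun t => exp (- (y * cosh t)) * cosh (mu * t)) t.
Proof.
apply (ex_derive_continuous (V := R_NormedModule)).
unfold cosh; auto_derive; easy.
Qed.

Lemma BesselK_integrand_bound (mu y t : R) :
  0 < y -> 0 <= t ->
  0 < exp (- (y * cosh t)) * cosh (mu * t)
    <= exp (2 * (Rabs mu + 1) ^ 2 / y) * exp (- t).
Proof.
intros Hy Ht; split.
- apply Rmult_lt_0_compat; [apply exp_pos | apply cosh_pos].
- eapply Rle_trans; [| now apply exp_cosh_decay].
  apply Rmult_le_compat_l; [apply Rlt_le, exp_pos | now apply cosh_le_exp_Rabs].
Qed.

Lemma BesselK_pos_is_RInt_gen (mu y : R) :
  0 < y ->
  0 < BesselK mu y /\
  is_RInt_gen (fun t => exp (- (y * cosh t)) * cosh (mu * t))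
    (at_point 0) (Rbar_locally p_infty) (BesselK mu y).
Proof.
intros Hy.
destruct (is_RInt_gen_pos_dominated
            (fun t => exp (- (y * cosh t)) * cosh (mu * t))
            (exp (2 * (Rabs mu + 1) ^ 2 / y))) as [l [Hl Hint]].
- apply BesselK_integrand_continuous.
- intros t Ht; apply BesselK_integrand_bound; lra.
- unfold BesselK; rewrite (is_RInt_gen_unique _ _ Hint); easy.
Qed.

Lemma BesselK_pos (mu y : R) : 0 < y -> 0 < BesselK mu y.
Proof. intros Hy; apply (BesselK_pos_is_RInt_gen mu y Hy). Qed.

Lemma is_RInt_gen_BesselK (mu y : R) :
  0 < y ->
  is_RInt_gen (fun t => exp (- (y * cosh t)) * cosh (mu * t))
    (at_point 0) (Rbar_locally p_infty) (BesselK mu y).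
Proof. intros Hy; apply (BesselK_pos_is_RInt_gen mu y Hy). Qed.

(** Both identities for [K] are pointwise identities between a combination of
    three integrands of consecutive index and a function whose integral is
    controlled by other means. *)
Lemma is_RInt_gen_BesselK_combination (g : R -> R) (a b c nu y : R) :
  0 < y ->
  (forall t, g t = exp (- (y * cosh t)) *
     (a * cosh ((nu + 1) * t) + b * cosh (nu * t) + c * cosh ((nu - 1) * t))) ->
  is_RInt_gen g (at_point 0) (Rbar_locally p_infty)
    (a * BesselK (nu + 1) y + b * BesselK nu y + c * BesselK (nu - 1) y).
Proof.
intros Hy Hg.
assert (Ha := is_RInt_gen_scal _ a _ (is_RInt_gen_BesselK (nu + 1) y Hy)).
assert (Hb := is_RInt_gen_scal _ b _ (is_RInt_gen_BesselK nu y Hy)).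
assert (Hc := is_RInt_gen_scal _ c _ (is_RInt_gen_BesselK (nu - 1) y Hy)).
assert (H := is_RInt_gen_plus _ _ _ _ (is_RInt_gen_plus _ _ _ _ Ha Hb) Hc).
revert H; apply is_RInt_gen_ext.
apply filter_forall; intros p x _.
rewrite Hg; unfold plus, scal; simpl; unfold mult; simpl; ring.
Qed.

(** * The recurrence in the index *)

(** Since [cosh ((nu + 1) t) - cosh ((nu - 1) t) = 2 sinh t sinh (nu t)], this
    expresses that the derivative of [exp (- y cosh t) sinh (nu t)], which
    vanishes at 0 and at infinity, has integral zero. *)
Lemma BesselK_recurrence (nu y : R) :
  0 < y ->
  y * (BesselK (nu + 1) y - BesselK (nu - 1) y) = 2 * nu * BesselK nu y.
Proof.
intros Hy.
pose (F := fun t => exp (- (y * cosh t)) * sinh (nu * t)).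
assert (HF : forall t, is_derive F t (exp (- (y * cosh t)) *
    (- y / 2 * cosh ((nu + 1) * t) + nu * cosh (nu * t)
     + y / 2 * cosh ((nu - 1) * t)))).
{ intros t; unfold F, sinh, cosh; auto_derive; [easy |].
  replace ((nu + 1) * t) with (nu * t + t) by ring.
  replace ((nu - 1) * t) with (nu * t + - t) by ring.
  rewrite !Ropp_plus_distr, Ropp_involutive, !exp_plus.
  unfold Rdiv; field. }
assert (HD : forall t, Derive F t = exp (- (y * cosh t)) *
    (- y / 2 * cosh ((nu + 1) * t) + nu * cosh (nu * t)
     + y / 2 * cosh ((nu - 1) * t))).
{ intros t; apply is_derive_unique, HF. }
assert (Hval : is_RInt_gen (Derive F) (at_point 0) (Rbar_locally p_infty)
          (- y / 2 * BesselK (nu + 1) y + nu * BesselK nu y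
           + y / 2 * BesselK (nu - 1) y)).
{ apply is_RInt_gen_BesselK_combination; [exact Hy | exact HD]. }
assert (Hzero : is_RInt_gen (Derive F) (at_point 0) (Rbar_locally p_infty)
                  (0 - 0)).
{ apply is_RInt_gen_Derive.
  - apply filter_forall; intros p x _; eexists; apply HF.
  - apply filter_forall; intros p x _.
    apply (continuous_ext _ _ _ (fun t => eq_sym (HD t))).
    apply (ex_derive_continuous (V := R_NormedModule)).
    unfold cosh; auto_derive; easy.
  - intros P HP; unfold filtermap, at_point.
    apply locally_singleton in HP.
    replace (F 0) with 0; [exact HP |].
    unfold F; rewrite Rmult_0_r, sinh_0; ring.
  - pose (C := exp (2 * (Rabs nu + 1) ^ 2 / y)).
    assert (Hdom : forall t, 0 < t -> - (C * exp (- t)) <= F t <= C * exp (- t)).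
    { intros t Ht; apply Rabs_le_between.
      unfold F; rewrite Rabs_mult, (Rabs_right (exp _))
        by (apply Rle_ge, Rlt_le, exp_pos).
      eapply Rle_trans; [| apply (BesselK_integrand_bound nu y t); lra].
      apply Rmult_le_compat_l; [apply Rlt_le, exp_pos | apply Rabs_sinh_le_cosh]. }
    assert (Hlim : forall c, is_lim (fun t => c * exp (- t)) p_infty 0).
    { intros c.
      replace (Finite 0) with (Rbar_mult c 0) by (simpl; f_equal; ring).
      apply is_lim_scal_l.
      apply is_lim_comp with m_infty.
      - apply is_lim_exp_m.
      - apply (is_lim_opp (fun t => t) p_infty p_infty), is_lim_id.
      - exists 0; easy. }
    apply (is_lim_le_le_loc (fun t => - C * exp (- t)) (fun t => C * exp (- t))
             F p_infty 0); try apply Hlim.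
    exists 0; intros t Ht; assert (H := Hdom t Ht); lra. }
assert (H1 := is_RInt_gen_unique _ _ Hval).
rewrite (is_RInt_gen_unique _ _ Hzero) in H1.
lra.
Qed.

(** * The Turan inequality *)

(** With [e = exp t] and [E = exp (nu t)], twice this expression is
    [(E / e) (lam e - 1)^2 + (lam - e)^2 / (E e)]; the squares vanish together
    only if [lam = e = 1 / e]. *)
Lemma cosh_quadratic_pos (lam nu t : R) :
  0 < t ->
  0 < lam ^ 2 * cosh ((nu + 1) * t) - 2 * lam * cosh (nu * t)
      + cosh ((nu - 1) * t).
Proof.
intros Ht.
assert (He : 1 < exp t) by (rewrite <- exp_0; now apply exp_increasing).
assert (HE := exp_pos (nu * t)).
assert (Hform :
  lam ^ 2 * cosh ((nu + 1) * t) - 2 * lam * cosh (nu * t) + cosh ((nu - 1) * t)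
  = (exp (nu * t) / exp t) / 2 * (lam * exp t - 1) ^ 2
    + / (exp (nu * t) * exp t) / 2 * (lam - exp t) ^ 2).
{ unfold cosh.
  replace ((nu + 1) * t) with (nu * t + t) by ring.
  replace ((nu - 1) * t) with (nu * t + - t) by ring.
  rewrite !Ropp_plus_distr, Ropp_involutive, !exp_plus, !exp_Ropp.
  field; lra. }
rewrite Hform.
set (p := exp (nu * t) / exp t / 2).
set (q := / (exp (nu * t) * exp t) / 2).
assert (Hp : 0 < p) by (unfold p; repeat apply Rdiv_lt_0_compat; lra).
assert (Hq : 0 < q).
{ unfold q; apply Rdiv_lt_0_compat; [apply Rinv_0_lt_compat; nra | lra]. }
destruct (Req_dec lam (exp t)) as [-> | Hne].
- apply Rplus_lt_le_0_compat.
  + apply Rmult_lt_0_compat; [easy | apply pow_lt; nra].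
  + apply Rmult_le_pos; [lra | apply pow2_ge_0].
- apply Rplus_le_lt_0_compat.
  + apply Rmult_le_pos; [lra | apply pow2_ge_0].
  + apply Rmult_lt_0_compat; [easy | apply pow2_gt_0; lra].
Qed.

Lemma BesselK_quadratic_pos (lam nu y : R) :
  0 < lam -> 0 < y ->
  0 < lam ^ 2 * BesselK (nu + 1) y - 2 * lam * BesselK nu y + BesselK (nu - 1) y.
Proof.
intros Hlam Hy.
pose (g := fun t => exp (- (y * cosh t)) *
  (lam ^ 2 * cosh ((nu + 1) * t) + - (2 * lam) * cosh (nu * t)
   + 1 * cosh ((nu - 1) * t))).
assert (Hval := is_RInt_gen_BesselK_combination g _ _ _ nu y Hy
                  (fun t => eq_refl)).
destruct (is_RInt_gen_pos_dominated g
            (lam ^ 2 * exp (2 * (Rabs (nu + 1) + 1) ^ 2 / y)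
             + exp (2 * (Rabs (nu - 1) + 1) ^ 2 / y))) as [l [Hl Hint]].
- intros t; apply (ex_derive_continuous (V := R_NormedModule)).
  unfold g, cosh; auto_derive; easy.
- intros t Ht; unfold g; split.
  + apply Rmult_lt_0_compat; [apply exp_pos |].
    assert (H := cosh_quadratic_pos lam nu t Ht); lra.
  + assert (H0 := BesselK_integrand_bound nu y t Hy (Rlt_le _ _ Ht)).
    assert (H1 := BesselK_integrand_bound (nu + 1) y t Hy (Rlt_le _ _ Ht)).
    assert (H2 := BesselK_integrand_bound (nu - 1) y t Hy (Rlt_le _ _ Ht)).
    assert (Hlam2 : 0 < lam ^ 2) by now apply pow_lt.
    (* The middle term is negative, as [lam] is positive. *)
    nra.
- rewrite <- (is_RInt_gen_unique _ _ Hint), (is_RInt_gen_unique _ _ Hval) in Hl.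
  lra.
Qed.

Lemma BesselK_turan (nu y : R) :
  0 < y -> BesselK nu y ^ 2 < BesselK (nu - 1) y * BesselK (nu + 1) y.
Proof.
intros Hy.
assert (H0 := BesselK_pos nu y Hy).
assert (H1 := BesselK_pos (nu + 1) y Hy).
(* The minimiser of the quadratic form. *)
assert (H := BesselK_quadratic_pos (BesselK nu y / BesselK (nu + 1) y) nu y
               (Rdiv_lt_0_compat _ _ H0 H1) Hy).
apply (Rmult_lt_compat_r _ _ _ H1) in H.
apply Rlt_0_minus.
rewrite Rmult_0_l in H.
eapply Rlt_le_trans; [exact H |].
apply Req_le; field; lra.
Qed.

(** * The bound on the ratio *)

Theorem proposition1p4 :
  forall nu : R, 0 < nu ->
  forall y : R, 0 < y ->
    BesselK nu y / BesselK (nu + 1) y < 1 / y * (sqrt (y ^ 2 + nu ^ 2) - nu).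
Proof.
intros nu Hnu y Hy.
assert (H0 := BesselK_pos nu y Hy).
assert (H1 := BesselK_pos (nu + 1) y Hy).
assert (Hrec := BesselK_recurrence nu y Hy).
assert (Hturan := BesselK_turan nu y Hy).
set (A := BesselK nu y) in *.
set (B := BesselK (nu + 1) y) in *.
set (D := BesselK (nu - 1) y) in *.
(* With [x = K_nu / K_{nu+1}] the goal squares to [(y x + nu)^2 < y^2 + nu^2]. *)
assert (Hx : (y * (A / B) + nu) ^ 2 < y ^ 2 + nu ^ 2).
{ apply Rlt_0_minus.
  replace (y ^ 2 + nu ^ 2 - (y * (A / B) + nu) ^ 2)
    with (y * (y * B ^ 2 - 2 * nu * A * B - y * A ^ 2) / B ^ 2) by (field; lra).
  replace (2 * nu * A * B) with (y * (B - D) * B) by (rewrite Hrec; ring).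
  apply Rdiv_lt_0_compat; [| now apply pow_lt].
  replace (y * (y * B ^ 2 - y * (B - D) * B - y * A ^ 2))
    with (y ^ 2 * (D * B - A ^ 2)) by ring.
  apply Rmult_lt_0_compat; [now apply pow_lt | lra]. }
assert (Hpos : 0 < A / B) by now apply Rdiv_lt_0_compat.
assert (Hroot : y * (A / B) + nu < sqrt (y ^ 2 + nu ^ 2)).
{ rewrite <- (sqrt_pow2 (y * (A / B) + nu)) by nra.
  apply sqrt_lt_1_alt; split; [apply pow2_ge_0 | exact Hx]. }
apply (Rmult_lt_reg_l y); [exact Hy |].
replace (y * (1 / y * (sqrt (y ^ 2 + nu ^ 2) - nu)))
  with (sqrt (y ^ 2 + nu ^ 2) - nu) by (field; lra).
lra.
Qed.
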